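(* Let $n\ge 2$ be odd, let $G=SD_{8n}$ (embedded in $S_{4n}$), and let $V$ be an $m$-dimensional complex inner product space. Let $h\in C^{\dag}_{even}$ and $h'\in C^{odd}_{2,3}\setminus\{n,3n\}$. Then $$\dim V^{4n}_{\chi_0}(G)=\frac{1}{8n}\Big[2nm^{n}+nm^{2n}+nm^{2n+2}+\sum_{k=0}^{4n-1}m^{\gcd(4n,k)}\Big],$$ $$\dim V^{4n}_{\chi_1}(G)=\frac{1}{8n}\Big[-2nm^{n}-nm^{2n}-nm^{2n+2}+\sum_{k=0}^{4n-1}m^{\gcd(4n,k)}\Big],$$ $$\dim V^{4n}_{\chi_2}(G)=\frac{1}{8n}\Big[m^{4n}+m^{2n}-2m^{n}+2\sum_{k\in C^{\dag}_{even}}m^{\gcd(4n,k)}-\sum_{k\in C^{\dag}_{odd}\cup\overline{C^{\dag}_{odd}}}m^{\gcd(4n,k)}-2nm^{n}+nm^{2n}+nm^{2n+2}\Big],$$ $$\dim V^{4n}_{\chi_3}(G)=\frac{1}{8n}\Big[m^{4n}+m^{2n}-2m^{n}+2\sum_{k\in C^{\dag}_{even}}m^{\gcd(4n,k)}-\sum_{k\in C^{\dag}_{odd}\cup\overline{C^{\dag}_{odd}}}m^{\gcd(4n,k)}+2nm^{n}-nm^{2n}-nm^{2n+2}\Big],$$ $$\dim V^{4n}_{\chi_4}(G)=\frac{1}{8n}\Big[m^{4n}-m^{2n}+\sum_{k\in C^{\dag}_{even}\cup\overline{C^{\dag}_{even}}}(-1)^{\frac k2}m^{\gcd(4n,k)}+nm^{2n+2}-nm^{2n}\Big],$$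 $$\dim V^{4n}_{\chi_5}(G)=\frac{1}{8n}\Big[m^{4n}-m^{2n}+\sum_{k\in C^{\dag}_{even}\cup\overline{C^{\dag}_{even}}}(-1)^{\frac k2}m^{\gcd(4n,k)}-nm^{2n+2}+nm^{2n}\Big],$$ $$\dim V^{4n}_{\chi_6}(G)=\frac{1}{8n}\Big[m^{4n}-m^{2n}+\sum_{k\in C^{\dag}_{even}\cup\overline{C^{\dag}_{even}}}(-1)^{\frac k2}m^{\gcd(4n,k)}+nm^{2n+2}-nm^{2n}\Big],$$ $$\dim V^{4n}_{\chi_7}(G)=\frac{1}{8n}\Big[m^{4n}-m^{2n}+\sum_{k\in C^{\dag}_{even}\cup\overline{C^{\dag}_{even}}}(-1)^{\frac k2}m^{\gcd(4n,k)}-nm^{2n+2}+nm^{2n}\Big],$$ $$\dim V^{4n}_{\varsigma_h}(G)=\frac{1}{2n}\Big[\sum_{k=0}^{4n-1}m^{\gcd(4n,k)}\cos\Big(\frac{hk\pi}{2n}\Big)\Big],$$ $$\dim V^{4n}_{\psi_{h'}}(G)=\frac{1}{4n}\Big[m^{4n}-m^{2n}+4\sum_{k\in C^{\dag}_{even}}m^{\gcd(4n,k)}\cos\Big(\frac{h'k\pi}{2n}\Big)\Big].$$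
   Context: $SD_{8n}=\langle a,b\mid a^{4n}=b^2=1,\ bab=a^{2n-1}\rangle$ is the semi-dihedral group of order $8n$, with elements $a^k, ba^k$ ($0\le k\le 4n-1$). It is regarded as a subgroup of $S_{4n}$ (permutations of $\{1,\dots,4n\}$, identified with the residues modulo $4n$) via $a: t\mapsto t+1$ and $b:t\mapsto (2n-1)t$ modulo $4n$. For a permutation group $G\le S_{4n}$ and an irreducible complex character $\chi$ of $G$, $P_\sigma$ is the operator on $\bigotimes^{4n}V$ with $P_\sigma(v_1\otimes\cdots\otimes v_{4n})=v_{\sigma^{-1}(1)}\otimes\cdots\otimes v_{\sigma^{-1}(4n)}$, and the symmetry class of tensors $V^{4n}_\chi(G)$ is the image of $T(G,\chi)=\frac{\chi(1)}{|G|}\sum_{\sigma\in G}\chi(\sigma)P_\sigma$ on $\bigotimes^{4n}V$. For $n$ odd: $C^{\dag}_{even}=\{2,4,\dots,2n-2\}$; $C^{odd}_{2,3}=\{1,3,5,\dots,n\}\cup\{2n+1,2n+3,\dots,3n\}$; and $C^{\dag}_{odd}$ is the set of odd integers $k$ with $1\le k\le n-1$ or $2n+1\le k\le 3n-1$ (so $C^{\dag}_{odd}=C^{odd}_{2,3}\setminus\{n,3n\}$). For a set $S$ of integers, $\overline S=\{\overline{s(2n-1)}\mid s\in S\}$, where $\overline r$ is the remainder of $r$ on division by $4n$. Also $\gcd(4n,0)=4n$. Characters of $SD_{8n}$ ($n$ odd, $i=\sqrt{-1}$): the linear characters are given by $(\chi(a),\chi(b))=(1,1),(1,-1),(-1,1),(-1,-1),(i,1),(i,-1),(-i,1),(-i,-1)$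 for $\chi=\chi_0,\chi_1,\dots,\chi_7$ respectively. For $h\in C^{\dag}_{even}$, $\varsigma_h$ is the degree 2 irreducible character with $\varsigma_h(a^k)=2\cos(\frac{hk\pi}{2n})$ and $\varsigma_h(ba^k)=0$ for all $k$. For $h'\in C^{odd}_{2,3}\setminus\{n,3n\}$, $\psi_{h'}$ is the degree 2 irreducible character with $\psi_{h'}(a^k)=2\cos(\frac{h'k\pi}{2n})$ for $k$ even, $\psi_{h'}(a^k)=2i\sin(\frac{h'k\pi}{2n})$ for $k$ odd, and $\psi_{h'}(ba^k)=0$ for all $k$.
   Formalization: The last formula is corrected: in the dimension for ψ_{h'} the leading terms are 2m^{4n} − 2m^{2n} instead of the printed m^{4n} − m^{2n}, which fails for m ≥ 2 (for n=3, m=2, h'=1 the dimension is 670, while the printed formula gives 334). *)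

(* Defs.v *)
From HB Require Import structures.
From mathcomp Require Import all_boot all_order all_algebra all_fingroup.
From mathcomp Require Import mxrepresentation.
From mathcomp Require Import sesquilinear.
From mathcomp Require Import complex.
From mathcomp Require Import reals trigo.
From mathcomp Require Import zify.

Set Implicit Arguments.
Unset Strict Implicit.
Unset Printing Implicit Defensive.

Import Order.TTheory GRing.Theory Num.Theory.
Local Open Scope ring_scope.
Local Open Scope complex_scope.

Section TensorPower.
Variables (K : fieldType) (N : nat) (V : vectType K).

Definition slot_set (v : {ffun 'I_N -> V}) (i : 'I_N) (x : V) :
    {ffun 'I_N -> V} :=
  [ffun j => if j == i then x else v j].

Definition multilinear (W : lmodType K) (phi : {ffun 'I_N -> V} -> W) : Prop :=
  forall (v : {ffun 'I_N -> V}) (i : 'I_N),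
    linear (fun x => phi (slot_set v i x)).

(* (T, tens) is an N-th tensor power of V, with
   tens v = v_0 (x) ... (x) v_(N-1), in the sense of the universal property. *)
Definition is_tensor_power (T : vectType K) (tens : {ffun 'I_N -> V} -> T) :
    Prop :=
  multilinear tens /\
  forall (W : lmodType K) (phi : {ffun 'I_N -> V} -> W), multilinear phi ->
    exists2 g : {linear T -> W},
      (forall v, g (tens v) = phi v) &
      (forall g' : {linear T -> W},
         (forall v, g' (tens v) = phi v) -> g' =1 g).

Definition is_permutation_operator (T : vectType K)
    (tens : {ffun 'I_N -> V} -> T) (P : 'S_N -> 'End(T)) : Prop :=
  forall (s : 'S_N) (v : {ffun 'I_N -> V}),
    P s (tens v) = tens [ffun i => v ((s^-1)%g i)].

(* Image of T(G, chi) = chi(1) / |G| * sum_(s in G) chi(s) P_s. *)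
Definition symmetrizer (T : vectType K) (P : 'S_N -> 'End(T))
    (G : {group 'S_N}) (chi : 'S_N -> K) : 'End(T) :=
  (chi 1%g / #|G|%:R) *: \sum_(s in G) chi s *: P s.

Definition symmetry_class (T : vectType K) (P : 'S_N -> 'End(T))
    (G : {group 'S_N}) (chi : 'S_N -> K) : {vspace T} :=
  limg (symmetrizer P G chi).

Lemma multilinear_eq (W : lmodType K) (phi psi : {ffun 'I_N -> V} -> W) :
  multilinear phi -> multilinear psi ->
  (forall f : {ffun 'I_N -> 'I_(\dim {:V})},
     phi [ffun i => (vbasis {:V})`_(f i)] =
     psi [ffun i => (vbasis {:V})`_(f i)]) ->
  phi =1 psi.
Proof.
move=> mphi mpsi eqb v.
suff H k : (k <= N)%N -> forall v : {ffun 'I_N -> V},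
    (forall i : 'I_N, (k <= i)%N ->
       exists j : 'I_(\dim {:V}), v i = (vbasis {:V})`_j) -> phi v = psi v.
  by apply: (H N) => // i; rewrite leqNgt ltn_ord.
elim: k => [|k IHk] kN {}v bv.
  have [f fE] := fin_all_exists (fun i => bv i (leq0n i)).
  have -> : v = [ffun i => (vbasis {:V})`_([ffun i => f i] i)].
    by apply/ffunP => i; rewrite !ffunE fE.
  exact: eqb.
pose i0 := Ordinal kN.
have vE : v = slot_set v i0 (v i0).
  by apply/ffunP => j; rewrite ffunE; case: eqP => [->|].
have lin_ext (chi : {ffun 'I_N -> V} -> W) : multilinear chi -> chi v =
    \sum_j coord (vbasis {:V}) j (v i0) *: chi (slot_set v i0 (vbasis {:V})`_j).
  move=> mchi; rewrite {1}vE {1}(coord_vbasis (memvf (v i0))).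
  pose L := GRing.isLinear.Build _ _ _ _ _ (mchi v i0).
  pose LL : {linear V -> W} := HB.pack (fun x => chi (slot_set v i0 x)) L.
  rewrite -[LHS]/(LL _) linear_sum; apply: eq_bigr => j _.
  by rewrite linearZ.
rewrite !lin_ext //; apply: eq_bigr => j _; congr (_ *: _).
apply: IHk => [|i]; first exact: ltnW.
rewrite leq_eqVlt => /orP[/eqP ki|ki].
  by exists j; rewrite ffunE; have -> : i == i0 by apply/eqP/val_inj.
have [j' j'E] := bv i ki; exists j'; rewrite ffunE.
by case: eqP => // ii0; rewrite ii0 /= ltnn in ki.
Qed.

Lemma tensor_power_exists :
  exists (T : vectType K) (tens : {ffun 'I_N -> V} -> T), is_tensor_power tens.
Proof.
pose I : finType := {ffun 'I_N -> 'I_(\dim {:V})}.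
pose X := vbasis {:V}.
pose T : vectType K := {ffun I -> K^o}.
pose tens (v : {ffun 'I_N -> V}) : T :=
  [ffun f : I => (\prod_i coord X (f i) (v i) : K^o)].
pose bas (f : I) : {ffun 'I_N -> V} := [ffun i => X`_(f i)].
have mtens : multilinear tens.
  move=> v i a x y; apply/ffunP => f; rewrite !ffunE.
  have E z : \prod_j coord X (f j) (slot_set v i z j) =
      coord X (f i) z * \prod_(j | j != i) coord X (f j) (v j).
    rewrite (bigD1 i) //= ffunE eqxx; congr (_ * _).
    by apply: eq_bigr => j /negPf ji; rewrite ffunE ji.
  by rewrite !E linearP mulrDl -mulrA.
have tens_bas f g : tens (bas f) g = (f == g)%:R.
  rewrite ffunE; have [<-|] := eqVneq f g.
    rewrite big1 // => i _; rewrite ffunE coord_free ?eqxx //.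
    exact: basis_free (vbasisP _).
  move=> fg; have [i fgi] : exists i, f i != g i.
    apply/existsP; rewrite -negb_forall; apply: contra fg => /forallP fg.
    by apply/eqP/ffunP => i; apply/eqP.
  rewrite (bigD1 i) //= ffunE coord_free ?(basis_free (vbasisP _)) //.
  by rewrite (negPf fgi) mul0r.
exists T, tens; split=> // W phi mphi.
pose g0 (t : T) : W := \sum_f (t f : K) *: phi (bas f).
have lg0 : linear g0.
  move=> a s t; rewrite /g0 scaler_sumr -big_split; apply: eq_bigr => f _ /=.
  by rewrite !ffunE scalerDl scalerA.
pose g : {linear T -> W} := HB.pack g0 (GRing.isLinear.Build _ _ _ _ g0 lg0).
have gtens v : g (tens v) = phi v.
  suff : g \o tens =1 phi by apply.
  apply: multilinear_eq => // [{}v i a x y|f] /=.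
    by rewrite mtens; exact: (linearP g).
  rewrite -[LHS]/(g0 (tens (bas f))) /g0 (bigD1 f) //= tens_bas eqxx scale1r.
  by rewrite big1 ?addr0 // => f' ff'; rewrite tens_bas eq_sym (negPf ff') scale0r.
exists g => // g' g'tens t.
have -> : t = \sum_f (t f : K) *: tens (bas f).
  apply/ffunP => f; rewrite sum_ffunE (bigD1 f) //= ffunE tens_bas eqxx.
  rewrite big1 ?addr0 => [|f' ff']; first by rewrite /GRing.scale /= mulr1.
  by rewrite ffunE tens_bas (negPf ff') scaler0.
rewrite !linear_sum; apply: eq_bigr => f _.
by rewrite !linearZ /= g'tens -gtens.
Qed.

Lemma permutation_operator_exists (T : vectType K)
    (tens : {ffun 'I_N -> V} -> T) :
  is_tensor_power tens -> exists P, is_permutation_operator tens P.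
Proof.
move=> [mtens univ].
suff /fin_all_exists[P PP] : forall s : 'S_N, exists Ps : 'End(T),
    forall v, Ps (tens v) = tens [ffun i => v ((s^-1)%g i)].
  by exists P => s v; exact: PP.
move=> s.
have [|g gE _] := univ T (fun v => tens [ffun i => v ((s^-1)%g i)]).
  move=> v i a x y.
  have E z : [ffun j => slot_set v i z ((s^-1)%g j)] =
      slot_set [ffun j => v ((s^-1)%g j)] (s i) z.
    apply/ffunP => j; rewrite !ffunE.
    by rewrite (can2_eq (permKV s) (permK s)).
  by rewrite !E mtens.
by exists (linfun g) => v; rewrite lfunE gE.
Qed.

End TensorPower.

Definition irr_character (K : fieldType) (gT : finGroupType) (G : {group gT})
    (chi : gT -> K) : Prop :=
  exists (d : nat) (rG : mx_representation K G d),
    mx_irreducible rG /\ {in G, forall g, chi g = \tr (rG g)}.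

Section SemiDihedral.
Variable n : nat.

Fact sd_mul_subproof (t : 'I_(4 * n)) :
  (((2 * n - 1) * t) %% (4 * n) < 4 * n)%N.
Proof. by rewrite ltn_pmod // (leq_ltn_trans (leq0n t)). Qed.

(* The points 0, ..., 4n-1 of 'I_(4 * n) are the residues modulo 4n. *)
Definition sd_mul (t : 'I_(4 * n)) : 'I_(4 * n) := Ordinal (sd_mul_subproof t).

Lemma sd_mulK : involutive sd_mul.
Proof.
move=> t; apply: val_inj => /=; rewrite modnMmr mulnA.
have n_gt0 : (0 < n)%N.
  by have := leq_ltn_trans (leq0n t) (ltn_ord t); rewrite muln_gt0.
have -> : ((2 * n - 1) * (2 * n - 1) = (n - 1) * (4 * n) + 1)%N.
  by nia.
by rewrite mulnDl mul1n mulnAC modnMDl modn_small.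
Qed.

Definition sd_a : 'S_(4 * n) := perm (@ordS_inj (4 * n)).
Definition sd_b : 'S_(4 * n) := perm (inv_inj sd_mulK).

Definition SD : {group 'S_(4 * n)} := <<[set sd_a; sd_b]>>%G.

Definition C_even : {set 'I_(4 * n)} :=
  [set k : 'I_(4 * n) | ~~ odd k & (2 <= k <= 2 * n - 2)%N].

Definition C_odd23 : {set 'I_(4 * n)} :=
  [set k : 'I_(4 * n) | odd k & (1 <= k <= n)%N || (2 * n + 1 <= k <= 3 * n)%N].

Definition C_odd : {set 'I_(4 * n)} :=
  [set k : 'I_(4 * n) | odd k & (1 <= k <= n - 1)%N || (2 * n + 1 <= k <= 3 * n - 1)%N].

Definition overline (S : {set 'I_(4 * n)}) : {set 'I_(4 * n)} :=
  [set sd_mul s | s in S].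

Definition sd_linear_character (R : realType) (x y : R[i])
    (chi : 'S_(4 * n) -> R[i]) : Prop :=
  [/\ irr_character SD chi, chi 1%g = 1, chi sd_a = x & chi sd_b = y].

Definition sd_varsigma (R : realType) (h : nat)
    (chi : 'S_(4 * n) -> R[i]) : Prop :=
  irr_character SD chi /\
  forall k : nat,
    chi (sd_a ^+ k)%g = (2 * cos ((h * k)%:R * pi / (2 * n)%:R))%:C /\
    chi (sd_b * sd_a ^+ k)%g = 0.

Definition sd_psi (R : realType) (h : nat)
    (chi : 'S_(4 * n) -> R[i]) : Prop :=
  irr_character SD chi /\
  forall k : nat,
    chi (sd_a ^+ k)%g =
      (if odd k then 0 +i* (2 * sin ((h * k)%:R * pi / (2 * n)%:R))
       else (2 * cos ((h * k)%:R * pi / (2 * n)%:R))%:C) /\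
    chi (sd_b * sd_a ^+ k)%g = 0.

End SemiDihedral.

(* Main.v *)
Require Import Defs.
From HB Require Import structures.
From mathcomp Require Import all_boot all_order all_algebra all_fingroup.
From mathcomp Require Import mxrepresentation.
From mathcomp Require Import sesquilinear.
From mathcomp Require Import complex.
From mathcomp Require Import reals trigo.
From mathcomp Require Import zify ring.

Set Implicit Arguments.
Unset Strict Implicit.
Unset Printing Implicit Defensive.

Import Order.TTheory GRing.Theory Num.Theory.
Local Open Scope ring_scope.
Local Open Scope complex_scope.

(* T(G, chi) is idempotent by Schur orthogonality, so its rank is its trace,
   chi(1) / |G| * sum_s chi(s) m^c(s), where c(s) is the number of cycles of s.
   In SD_8n with n odd, a^k has gcd(4n, k) cycles, and b a^k has n cycles for k
   odd, 2n + 2 for k = 0 mod 4 (an involution with 4 fixed points) and 2n for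
   k = 2 mod 4 (an involution without fixed points). As the rank is real, only
   the real parts of the character values matter, which removes the odd k in the
   formulas for chi_4, ..., chi_7 and psi; the other values of k are paired by
   the action k -> (2n - 1) k of b. *)

(* With [b] a basis of the image of the idempotent [E], both sides are
   [\sum_j coord_j (E b_j)] after expanding [b_j] along the [t f]. *)
Lemma dim_limg_idempotent (K : fieldType) (T : vectType K) (I : finType)
    (t : I -> T) (c : I -> {linear T -> K^o}) (E : 'End(T)) :
  (forall x, x = \sum_f c f x *: t f) -> (forall x, E (E x) = E x) ->
  (\dim (limg E))%:R = \sum_f c f (E (t f)) :> K.
Proof.
move=> tE EE; set b := vbasis (limg E).
have bE j : E b`_j = b`_j.
  have [jb|jb] := ltnP j (size b); last by rewrite nth_default ?linear0.
  have /memv_imgP[y _ ->] : b`_j \in limg E by apply: vbasis_mem; exact: mem_nth.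
  by rewrite EE.
have EbE x : E x = \sum_j coord b j (E x) *: b`_j.
  by apply: coord_vbasis; exact: memv_img (memvf x).
have -> : (\dim (limg E))%:R = \sum_j coord b j (E b`_j) :> K.
  rewrite -[in LHS](card_ord (\dim (limg E))) -sum1_card natr_sum.
  apply: eq_bigr => j _; rewrite bE coord_free ?eqxx //.
  exact: basis_free (vbasisP _).
transitivity (\sum_(j < \dim (limg E)) \sum_f (c f b`_j : K) * coord b j (E (t f))).
  apply: eq_bigr => j _; rewrite {1}(tE b`_j) !linear_sum; apply: eq_bigr => f _.
  by rewrite !linearZ.
rewrite exchange_big; apply: eq_bigr => f _ /=.
rewrite [in RHS]EbE linear_sum; apply: eq_bigr => j _.
by rewrite linearZ mulrC.
Qed.

(** * Coordinates on a tensor power and traces of combinations of the operators [P s] *)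

Section PermutationOperators.
Variables (K : fieldType) (N : nat) (V : vectType K) (T : vectType K).
Variables (tens : {ffun 'I_N -> V} -> T) (tensP : is_tensor_power tens).
Variables (P : 'S_N -> 'End(T)) (PP : is_permutation_operator tens P).

Let I := {ffun 'I_N -> 'I_(\dim {:V})}.
Let base (f : I) : {ffun 'I_N -> V} := [ffun i => (vbasis {:V})`_(f i)].

(** The products of coordinates [C f] are multilinear, so they factor through [T]; these factors
    form the basis dual to the tensors of basis vectors. That those tensors span comes from the
    uniqueness half of the universal property. *)
Lemma tensor_power_coord : exists c : I -> {linear T -> K^o},
  (forall f g, c f (tens (base g)) = (f == g)%:R) /\
  (forall x, x = \sum_f c f x *: tens (base f)).
Proof.
have [mtens univ] := tensP.
pose X := vbasis {:V}.
pose C (f : I) (v : {ffun 'I_N -> V}) : K^o := \prod_i coord X (f i) (v i).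
have mC f : multilinear (C f).
  move=> v i a x y.
  have E z : C f (slot_set v i z) =
      coord X (f i) z * \prod_(j | j != i) coord X (f j) (v j).
    rewrite /C (bigD1 i) //= ffunE eqxx; congr (_ * _).
    by apply: eq_bigr => j /negPf ji; rewrite ffunE ji.
  by rewrite !E linearP mulrDl -mulrA.
have CB f g : C f (base g) = (f == g)%:R.
  have coordX (i j : 'I__) : coord X i X`_j = (i == j)%:R.
    by rewrite coord_free ?(basis_free (vbasisP _)) // eq_sym.
  have [->|fg] := eqVneq f g.
    by rewrite /C big1 // => i _; rewrite ffunE coordX eqxx.
  have [i fgi] : exists i, f i != g i.
    apply/existsP; rewrite -negb_forall; apply: contra fg => /forallP fg.
    by apply/eqP/ffunP => i; apply/eqP.
  by rewrite /C (bigD1 i) //= ffunE coordX (negPf fgi) mul0r.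
have /fin_all_exists[c cE] : forall f, exists cf : {linear T -> K^o},
    forall v, cf (tens v) = C f v.
  by move=> f; have [g gE _] := univ _ _ (mC f); exists g.
exists c; split=> [f g|x]; first by rewrite cE.
(* The factorisation of [tens] through itself is unique, and both the identity and the expansion map
   [s] provide one, so they agree. *)
have [g gE guniq] := univ T tens mtens.
pose s0 (x : T) : T := \sum_f (c f x : K) *: tens (base f).
have ls0 : linear s0.
  move=> a u v; rewrite /s0 scaler_sumr -big_split; apply: eq_bigr => f _ /=.
  by rewrite linearP scalerDl scalerA.
pose s : {linear T -> T} := HB.pack s0 (GRing.isLinear.Build _ _ _ _ s0 ls0).
pose id' : {linear T -> T} := idfun.
transitivity (g x); first exact: (guniq id').
symmetry; apply: (guniq s) => v.
suff : s \o tens =1 tens by apply.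
apply: multilinear_eq => // [{}v i a y z|f] /=.
  by rewrite mtens; exact: (linearP s).
rewrite -[LHS]/(s0 _) /s0 (bigD1 f) //= -/(base f) !cE CB eqxx scale1r.
by rewrite big1 ?addr0 // => f' ff'; rewrite cE CB (negPf ff') scale0r.
Qed.

(** The order is reversed because [(t * s)%g] applies [t] first. *)
Lemma permutation_operatorM (s t : 'S_N) x : P s (P t x) = P (t * s)%g x.
Proof.
have [c [_ cE]] := tensor_power_coord; rewrite (cE x) !linear_sum; apply: eq_bigr => f _.
rewrite !linearZ /= !PP; congr (_ *: tens _); apply/ffunP => i.
by rewrite !ffunE invMg permM.
Qed.

(** An invariant function is constant on the cycles of [s], and its value on each cycle is a free
    choice in [D]. *)
Lemma card_perm_invariant (D : finType) (s : 'S_N) :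
  #|[set f : {ffun 'I_N -> D} | [forall i, f (s i) == f i]]| =
  (#|D| ^ #|porbits s|)%N.
Proof.
pose O := {A : {set 'I_N} | A \in porbits s}.
have so i : porbit s i \in porbits s by apply: imset_f.
pose o i : O := exist (fun A => A \in porbits s) (porbit s i) (so i).
pose F (g : {ffun O -> D}) : {ffun 'I_N -> D} := [ffun i => g (o i)].
have os i : o (s i) = o i by apply: val_inj; exact: (porbit_perm s 1 i).
have Oo (A : O) : exists i, A = o i.
  by case: A => A AO; have /imsetP[i _ AE] := AO; exists i; exact: val_inj.
have -> : [set f : {ffun 'I_N -> D} | [forall i, f (s i) == f i]] = F @: setT.
  apply/setP => f; rewrite inE; apply/forallP/imsetP => [fs|[g _ ->] i]; last first.
    by rewrite !ffunE os.
  have fo i j : o i = o j -> f i = f j.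
    move=> /(congr1 val) /= /eqP; rewrite eq_porbit_mem => /porbitP[k ->].
    elim: k => [|k IHk]; first by rewrite expg0 perm1.
    by rewrite expgSr permM (eqP (fs _)).
  (* [r] picks a representative of each cycle. *)
  have [r rE] := fin_all_exists Oo.
  exists [ffun A => f (r A)] => //; apply/ffunP => i; rewrite !ffunE.
  by apply: fo; rewrite -rE.
rewrite card_imset => [|g g' /ffunP gg'].
  by rewrite cardsT card_ffun card_sig; congr (_ ^ _)%N; exact: eq_card.
by apply/ffunP => A; have [i ->] := Oo A; have := gg' i; rewrite !ffunE.
Qed.

(** The rank of an idempotent is its trace, and [P s] permutes the basis tensors, so its trace
    counts the index functions that [s] leaves invariant. *)
Lemma dim_limg_permutation_operators (G : {group 'S_N}) (a : 'S_N -> K)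
    (E := \sum_(s in G) a s *: P s) : (forall x, E (E x) = E x) ->
  (\dim (limg E))%:R = \sum_(s in G) a s * (\dim {:V} ^ #|porbits s|)%:R :> K.
Proof.
move=> EE; have [c [cB cE]] := tensor_power_coord.
rewrite (dim_limg_idempotent cE EE).
transitivity (\sum_f \sum_(s in G) a s * (c f (P s (tens (base f))) : K)).
  apply: eq_bigr => f _; rewrite sum_lfunE linear_sum; apply: eq_bigr => s _.
  by rewrite scale_lfunE linearZ.
rewrite exchange_big; apply: eq_bigr => s _ /=; rewrite -mulr_sumr; congr (_ * _).
(* [P s] moves indices by the inverse of [s], which has the same cycles as [s]. *)
rewrite -[X in (X ^ _)%N]card_ord -porbitsV -card_perm_invariant -sum1_card natr_sum.
rewrite [RHS]big_mkcond; apply: eq_bigr => f _; rewrite PP.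
have -> : [ffun i => base f ((s^-1)%g i)] = base [ffun i => f ((s^-1)%g i)].
  by apply/ffunP => i; rewrite !ffunE.
rewrite cB inE.
suff -> : (f == [ffun i => f (s^-1 i)%g]) = [forall i, f (s^-1 i)%g == f i].
  by case: ifP.
apply/eqP/forallP => [/ffunP fs i|fs]; first by rewrite [f i]fs ffunE.
by apply/ffunP => i; rewrite ffunE (eqP (fs i)).
Qed.

End PermutationOperators.

(** * Schur orthogonality and the dimension of a symmetry class *)

Section IrreducibleCharacters.
Variables (K : numClosedFieldType) (gT : finGroupType) (G : {group gT}).

(** The average commutes with the representation, so it is scalar by Schur's lemma over a closed
    field; taking traces gives the scalar. *)
Lemma mx_irr_avg_scalar d (rG : mx_representation K G d) (A : 'M_d) :
  mx_irreducible rG ->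
  \sum_(g in G) rG g^-1%g *m A *m rG g = (#|G|%:R * \tr A / d%:R)%:M.
Proof.
move=> irrG; have /group_closure_closed_field absG := irrG.
have d_gt0 : (0 < d)%N by have /mx_irrP[] := irrG.
set B := LHS.
have /is_scalar_mxP[l Bl] : is_scalar_mx B.
  apply: (mx_abs_irr_cent_scalar absG); apply/centgmxP => x Gx.
  rewrite /B mulmx_suml mulmx_sumr (reindex_inj (mulIg x^-1%g)) /=.
  rewrite (eq_bigl (mem G)) => [|g]; last by rewrite groupMr ?groupV.
  apply: eq_bigr => g Gg; rewrite invMg invgK !repr_mxM ?groupV ?groupMl ?groupV //.
  by rewrite -!mulmxA -repr_mxM ?groupV // mulVg repr_mx1 mulmx1.
have trB : \tr B = #|G|%:R * \tr A.
  rewrite /B raddf_sum mulr_natl -sumr_const; apply: eq_bigr => g Gg /=.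
  by rewrite mxtrace_mulC mulmxA -repr_mxM ?groupV // mulgV repr_mx1 mul1mx.
rewrite Bl -trB Bl mxtrace_scalar -[l *+ _]mulr_natr mulfK //.
by rewrite pnatr_eq0 -lt0n.
Qed.

(** The sum of [chi s *: rG s^-1] over the group is the scalar [#|G| / d]; multiplying it by [rG x]
    and taking traces gives the identity. *)
Lemma irr_character_convolution (chi : gT -> K) x :
  irr_character G chi -> x \in G ->
  \sum_(s in G) chi s * chi (x * s^-1)%g = #|G|%:R / chi 1%g * chi x.
Proof.
move=> [d [rG [irrG chiE]]] Gx.
have SchiE : \sum_(s in G) chi s *: rG s^-1%g = (#|G|%:R / d%:R)%:M.
  apply/matrixP => k l; rewrite summxE.
  (* The [(k, i)] entry of this product is the [(k, l)] entry of [rG s^-1] times the [i]-th diagonal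
     entry of [rG s]; summing over [i] produces [chi s]. *)
  transitivity (\sum_(s in G) \sum_i (rG s^-1%g *m delta_mx l i *m rG s) k i).
    apply: eq_bigr => s Gs; rewrite mxE chiE // mulr_suml; apply: eq_bigr => i _.
    rewrite !mxE (bigD1 i) //= big1 ?addr0 => [|j ji].
      rewrite !mxE (bigD1 l) //= mxE !eqxx mulr1 big1 ?addr0; first by rewrite mulrC.
      by move=> j jl; rewrite mxE (negPf jl) mulr0.
    by rewrite !mxE big1 ?mul0r // => j' _; rewrite mxE (negPf ji) andbF mulr0.
  rewrite exchange_big /=.
  transitivity (\sum_i (#|G|%:R * \tr (delta_mx l i : 'M[K]_d) / d%:R)%:M k i).
    by apply: eq_bigr => i _; rewrite -(mx_irr_avg_scalar (delta_mx l i) irrG) summxE.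
  rewrite (bigD1 k) //= big1 ?addr0 => [|i ik].
    have -> : \tr (delta_mx l k : 'M[K]_d) = (k == l)%:R.
      rewrite /mxtrace (bigD1 k) //= big1 ?addr0 => [|j /negPf jk].
        by rewrite mxE eqxx andbT.
      by rewrite mxE jk andbF.
    by rewrite !mxE eqxx mulr1n; case: eqP => _; rewrite ?mulr1 // mulr0 mul0r.
  by rewrite mxE eq_sym (negPf ik).
have d1 : chi 1%g = d%:R by rewrite chiE // repr_mx1 mxtrace1.
rewrite d1 chiE // -[RHS]mxtraceZ -mul_mx_scalar -SchiE mulmx_sumr raddf_sum.
apply: eq_bigr => s Gs /=.
by rewrite -scalemxAr mxtraceZ -repr_mxM ?groupV // -chiE // groupMl // groupV.
Qed.

(** The value at 1 is the degree, so the matrices are 1 by 1 and equal their traces. *)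
Lemma linear_irr_characterM (chi : gT -> K) :
  irr_character G chi -> chi 1%g = 1 -> {in G &, {morph chi : x y / (x * y)%g >-> x * y}}.
Proof.
move=> [d [rG [_ chiE]]] chi1.
move/eqP: chi1; rewrite chiE // repr_mx1 mxtrace1 pnatr_eq1 => /eqP d1.
move: rG chiE; rewrite d1 => rG chiE x y Gx Gy.
rewrite !chiE ?groupM // repr_mxM // /mxtrace !big_ord1.
by rewrite mxE big_ord1.
Qed.

End IrreducibleCharacters.

(** The factor [chi 1 / #|G|] is the one for which the convolution identity makes the symmetrizer
    idempotent; its rank is then its trace. *)
Lemma dim_symmetry_class (K : numClosedFieldType) (N : nat) (V T : vectType K)
    (tens : {ffun 'I_N -> V} -> T) (P : 'S_N -> 'End(T)) (G : {group 'S_N})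
    (chi : 'S_N -> K) :
  is_tensor_power tens -> is_permutation_operator tens P -> irr_character G chi ->
  (\dim (symmetry_class P G chi))%:R =
  chi 1%g / #|G|%:R * \sum_(s in G) chi s * (\dim {:V} ^ #|porbits s|)%:R.
Proof.
move=> tensP PP irrchi; rewrite /symmetry_class.
set c := chi 1%g / #|G|%:R.
have symE : symmetrizer P G chi = \sum_(s in G) (c * chi s) *: P s.
  by rewrite /symmetrizer scaler_sumr; apply: eq_bigr => s _; rewrite scalerA.
have cnz : c * (#|G|%:R / chi 1%g) = 1.
  have [d [rG [/mx_irrP[d0 _] chiE]]] := irrchi.
  rewrite mulrA divfK ?divff ?pnatr_eq0 -?lt0n ?cardG_gt0 //.
  by rewrite chiE // repr_mx1 mxtrace1 pnatr_eq0 -lt0n.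
rewrite symE (dim_limg_permutation_operators tensP PP); last first.
  move=> x; rewrite [in LHS]sum_lfunE.
  transitivity (\sum_(s in G) \sum_(t in G) (c * chi s * (c * chi t)) *: P (t * s)%g x).
    apply: eq_bigr => s _; rewrite scale_lfunE sum_lfunE linear_sum scaler_sumr.
    apply: eq_bigr => t _; rewrite scale_lfunE linearZ scalerA /=.
    by rewrite (permutation_operatorM tensP PP).
  (* With [y = t * s], the coefficient of [P y] in the square becomes a convolution of [chi] with
     itself. *)
  transitivity (\sum_(s in G) \sum_(y in G)
      (c * chi s * (c * chi (y * s^-1)%g)) *: P y x).
    apply: eq_bigr => s Gs; rewrite (reindex_inj (mulIg s^-1%g)) /=.
    by apply: eq_big => y; rewrite ?groupMr ?groupV // => Gy; rewrite mulgKV.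
  rewrite exchange_big sum_lfunE; apply: eq_bigr => y Gy /=.
  rewrite scale_lfunE -scaler_suml; congr (_ *: _).
  transitivity (c * (c * \sum_(s in G) chi s * chi (y * s^-1)%g)).
    by rewrite !mulr_sumr; apply: eq_bigr => s _; rewrite mulrACA !mulrA.
  by rewrite irr_character_convolution // [c * (_ * chi y)]mulrA cnz mul1r.
by rewrite mulr_sumr; apply: eq_bigr => s _; rewrite mulrA.
Qed.

(** * Counting the cycles of a permutation *)

Section PorbitCount.
Variables (D : finType) (s : {perm D}).

(** The cycle length is a multiple of [d], as that power fixes [x], and at most [d], as exponents
    matter only modulo [d]. *)
Lemma card_porbit_order d x : (0 < d)%N ->
  (forall j, ((s ^+ j)%g x == x) = (d %| j)%N) -> #|porbit s x| = d.
Proof.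
move=> d_gt0 sx.
have dc : (d %| #|porbit s x|)%N by rewrite -sx permX iter_porbit.
apply/eqP; rewrite eqn_leq (dvdn_leq _ dc) ?lt0n ?card_porbit_neq0 // andbT.
have -> : porbit s x = [set (s ^+ (i : 'I_d))%g x | i : 'I_d].
  apply/setP => y; apply/porbitP/imsetP => [[i ->]|[i _ ->]]; last by exists i.
  exists (Ordinal (ltn_pmod i d_gt0)) => //=.
  rewrite {1}(divn_eq i d) expgD permM; congr ((s ^+ _)%g _).
  by apply/eqP; rewrite sx dvdn_mull.
by rewrite (leq_trans (leq_imset_card _ _)) // card_ord.
Qed.

Lemma sum_porbits (F : D -> nat) c :
  (forall x, \sum_(y in porbit s x) F y = c)%N ->
  (\sum_x F x = #|porbits s| * c)%N.
Proof.
move=> Fc; rewrite (partition_big_imset (porbit s)) /= -sum_nat_const.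
apply: eq_bigr => _ /imsetP[x _ ->]; rewrite -(Fc x); apply: eq_bigl => y.
by rewrite eq_porbit_mem.
Qed.

Lemma card_porbits_uniform d :
  (forall x, #|porbit s x| = d) -> (#|D| = #|porbits s| * d)%N.
Proof.
move=> sd; transitivity (\sum_(x : D) 1)%N; first by rewrite sum1_card.
apply: sum_porbits => x; by rewrite sum1_card sd.
Qed.

(** Give each point weight 1, and 2 if it is fixed: every cycle, a fixed point or a transposed pair,
    then has total weight 2. *)
Lemma card_porbits_involutive :
  involutive s -> (#|D| + #|[set x | s x == x]| = #|porbits s| * 2)%N.
Proof.
move=> ss; pose F x := (1 + (s x == x))%N.
have -> : (#|D| + #|[set x | s x == x]| = \sum_x F x)%N.
  rewrite big_split /= sum1_card; congr addn; rewrite -sum1_card big_mkcond.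
  by apply: eq_bigr => x _; rewrite inE; case: eqP.
apply: sum_porbits => x.
have -> : porbit s x = [set x; s x].
  apply/setP => y; rewrite !inE; apply/porbitP/orP => [[i ->]|[/eqP->|/eqP->]].
  - elim: i => [|i]; first by left; rewrite expg0 perm1.
    by rewrite expgSr permM => -[/eqP->|/eqP->]; [right|left; rewrite ss].
  - by exists 0%N; rewrite expg0 perm1.
  - by exists 1%N; rewrite expg1.
have [sx|sx] := eqVneq (s x) x; first by rewrite sx setUid big_set1 /F sx eqxx.
by rewrite big_setU1 ?inE 1?eq_sym // big_set1 /F ss (eq_sym x) (negPf sx).
Qed.

End PorbitCount.

(** * Normal forms in the semi-dihedral group and the cycle counts of its elements *)

Section SemiDihedralElements.
Variable n : nat.
Hypothesis n_ge2 : (2 <= n)%N.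
Local Notation a := (sd_a n).
Local Notation b := (sd_b n).
Local Notation SD := (SD n).

Let N_gt0 : (0 < 4 * n)%N. Proof. by rewrite muln_gt0 (ltnW n_ge2). Qed.

Lemma sd_aXE k (t : 'I_(4 * n)) : (a ^+ k)%g t = ((t + k) %% (4 * n))%N :> nat.
Proof.
elim: k => [|k IHk]; first by rewrite expg0 perm1 addn0 modn_small.
by rewrite expgSr permM permE /= IHk -addn1 modnDml -addnA addn1.
Qed.

Lemma sd_bE (t : 'I_(4 * n)) : b t = sd_mul t.
Proof. by rewrite permE. Qed.

Lemma sd_baXE k (t : 'I_(4 * n)) :
  (b * a ^+ k)%g t = (((2 * n - 1) * t + k) %% (4 * n))%N :> nat.
Proof. by rewrite permM sd_aXE sd_bE /= modnDml. Qed.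

Lemma sd_aX_mod k : (a ^+ (k %% (4 * n))%N = a ^+ k)%g.
Proof. by apply/permP => t; apply: val_inj; rewrite /= !sd_aXE modnDmr. Qed.

Lemma sd_bb : (b * b = 1)%g.
Proof. by apply/permP => t; rewrite permM perm1 !sd_bE sd_mulK. Qed.

Lemma sd_ab k : (a ^+ k * b = b * a ^+ ((2 * n - 1) * k)%N)%g.
Proof.
apply/permP => t; apply: val_inj; rewrite /= sd_baXE permM sd_bE /= sd_aXE.
by rewrite modnMmr mulnDr.
Qed.

Lemma sd_aX_inj : injective (fun k : 'I_(4 * n) => (a ^+ k)%g).
Proof.
move=> k l /permP/(_ (Ordinal N_gt0))/(congr1 val) /=.
by rewrite !sd_aXE !add0n !modn_small //; exact: val_inj.
Qed.

(** Equality at the point 0 forces [k = l] modulo [4n]; at the point 1 it then forces [2n - 1 = 1]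
    modulo [4n], which fails for [n >= 2]. *)
Lemma sd_aX_neq_baX k l : (a ^+ k)%g != (b * a ^+ l)%g.
Proof.
apply/eqP => /permP akl.
have := congr1 val (akl (Ordinal N_gt0)); rewrite /= sd_aXE sd_baXE /= muln0 !add0n => kl.
have N1 : (1 < 4 * n)%N by lia.
have := congr1 val (akl (Ordinal N1)); rewrite /= sd_aXE sd_baXE /= muln1.
move=> /eqP; rewrite -modnDmr kl modnDmr eqn_modDr !modn_small //; lia.
Qed.

(** The relations [sd_ab] and [sd_bb] close the right-hand side under products. *)
Lemma SD_E : SD = [set (a ^+ (k : 'I_(4 * n)))%g | k : 'I_(4 * n)] :|:
                  [set (b * a ^+ (k : 'I_(4 * n)))%g | k : 'I_(4 * n)] :> {set _}.
Proof.
set A := imset _ _; set B := imset _ _.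
have aA k : (a ^+ k)%g \in A.
  by rewrite -sd_aX_mod; apply/imsetP; exists (Ordinal (ltn_pmod k N_gt0)).
have baB k : (b * a ^+ k)%g \in B.
  by rewrite -sd_aX_mod; apply/imsetP; exists (Ordinal (ltn_pmod k N_gt0)).
have gAB : group_set (A :|: B).
  apply/group_setP; split=> [|x y]; first by rewrite inE -(expg0 a) aA.
  rewrite !inE => /orP[]/imsetP[k _ ->] /orP[]/imsetP[l _ ->].
  - by rewrite -expgD aA.
  - by rewrite mulgA sd_ab -mulgA -expgD baB orbT.
  - by rewrite -mulgA -expgD baB orbT.
  - by rewrite mulgA -(mulgA b) sd_ab !mulgA sd_bb mul1g -expgD aA.
apply/eqP; rewrite eqEsubset; apply/andP; split.
  rewrite -[A :|: B]/(gval (Group gAB)) gen_subG subUset !sub1set !inE.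
  by rewrite -{1}(expg1 a) aA -(mulg1 b) -(expg0 a) baB orbT.
have aG : a \in SD by rewrite mem_gen // !inE eqxx.
have bG : b \in SD by rewrite mem_gen // !inE eqxx orbT.
by apply/subsetP => x; rewrite inE => /orP[]/imsetP[k _ ->]; rewrite ?groupM ?groupX.
Qed.

Lemma sum_SD (W : nmodType) (F : 'S_(4 * n) -> W) :
  \sum_(s in SD) F s =
  \sum_(k < 4 * n) F (a ^+ k)%g + \sum_(k < 4 * n) F (b * a ^+ k)%g.
Proof.
rewrite SD_E; set A := imset _ _; set B := imset _ _.
rewrite (eq_bigl [predU A & B]) => [|s]; last by rewrite !inE.
rewrite bigU /=; last first.
  rewrite disjoint_subset; apply/subsetP => _ /imsetP[k _ ->]; rewrite !inE.
  by apply/imsetP => -[l _ /eqP]; apply/negP/sd_aX_neq_baX.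
rewrite !big_imset //= => [k l _ _ /mulgI|k l _ _]; exact: sd_aX_inj.
Qed.

Lemma card_SD : #|SD| = (8 * n)%N.
Proof. by rewrite -sum1_card sum_SD !sum1_card card_ord; lia. Qed.

(** Every cycle has length [4n / g]: the [j]-th power fixes a point exactly when [4n] divides [k j],
    and [4n / g] is coprime to [k / g]. *)
Lemma card_porbits_sd_aX k : #|porbits (a ^+ k)%g| = gcdn (4 * n) k.
Proof.
set g := gcdn _ _.
have g_gt0 : (0 < g)%N by rewrite gcdn_gt0 N_gt0.
have gN : (g %| 4 * n)%N by exact: dvdn_gcdl.
have d_gt0 : (0 < 4 * n %/ g)%N by rewrite divn_gt0 // dvdn_leq.
have := @card_porbits_uniform _ (a ^+ k)%g (4 * n %/ g).
rewrite card_ord => H; apply/eqP.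
rewrite -(eqn_pmul2r d_gt0) -H => [|t]; first by rewrite [(g * _)%N]mulnC divnK.
apply: card_porbit_order => // j.
rewrite -expgM -val_eqE /= sd_aXE -[X in _ == X](modn_small (ltn_ord t)).
rewrite -[X in _ == X %[mod _]]addn0 eqn_modDl mod0n.
have kE : (k = k %/ g * g)%N by rewrite divnK ?dvdn_gcdr.
have cop : coprime (4 * n %/ g) (k %/ g).
  by rewrite /coprime -(eqn_pmul2r g_gt0) mul1n muln_gcdl -kE divnK.
rewrite -/(dvdn _ _) -{1}(divnK gN) {1}kE mulnAC dvdn_pmul2r //.
by rewrite Gauss_dvdr.
Qed.

Hypothesis n_odd : odd n.

Lemma sd_baX_sqr k : ((b * a ^+ k) * (b * a ^+ k) = a ^+ (2 * n * k)%N)%g.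
Proof.
rewrite mulgA -(mulgA b) sd_ab !mulgA sd_bb mul1g -expgD; congr (_ ^+ _)%g; nia.
Qed.

(* For k odd the square of b a^k is the fixed-point free translation by 2n. *)
Lemma card_porbits_sd_baX_odd k : odd k -> #|porbits (b * a ^+ k)%g| = n.
Proof.
move=> k_odd; set s := (b * a ^+ k)%g.
have ssX j t : ((s ^+ (2 * j))%g t == t) = ~~ odd j.
  rewrite expgM expgS expg1 sd_baX_sqr -expgM -val_eqE /= sd_aXE.
  rewrite -[X in _ == X](modn_small (ltn_ord t)).
  rewrite -[X in _ == X %[mod _]]addn0 eqn_modDl mod0n -/(dvdn _ _).
  have -> : (4 * n = 2 * n * 2)%N by lia.
  rewrite -[(2 * n * k * j)%N]mulnA dvdn_pmul2l ?muln_gt0 ?(ltnW n_ge2) //.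
  by rewrite dvdn2 oddM k_odd.
have := @card_porbits_uniform _ s 4.
rewrite card_ord => sumE; suff /sumE : forall t, #|porbit s t| = 4 by lia.
move=> t; apply: card_porbit_order => // j.
have := odd_double_half j; rewrite -mul2n; case: (boolP (odd j)) => [j_odd _|_ /= jE].
  have -> : (4 %| j)%N = false by lia.
  (* A point fixed by an odd power [s ^+ j] would be fixed by [s ^+ (2 * j)], against [ssX]. *)
  apply/eqP => st; have := ssX j t; rewrite mul2n -addnn expgD permM !st eqxx.
  by rewrite j_odd.
by rewrite -{1}jE add0n ssX; lia.
Qed.

(** With [n = 2p + 1] and [k = 2k'], the point [t] is fixed when [2n] divides [2pt + k']. Modulo 2
    this says that [k'] is even; modulo [n], where [2p = -1], it says [t = k'], with four solutions
    below [4n]. *)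
Lemma card_fix_sd_baX k : ~~ odd k ->
  #|[set t | (b * a ^+ k)%g t == t]| = (if 4 %| k then 4 else 0)%N.
Proof.
move=> k_even; have [k' kE] : exists k', (k = k' * 2)%N by exists (k %/ 2)%N; lia.
have [p nE] : exists p, (n = p * 2 + 1)%N by exists (n %/ 2)%N; lia.
have n_gt0 : (0 < n)%N by apply: ltnW.
have fixE (t : 'I_(4 * n)) :
    ((b * a ^+ k)%g t == t) = (2 * n %| p * 2 * t + k')%N.
  rewrite -val_eqE /= sd_baXE -[X in _ == X](modn_small (ltn_ord t)).
  have -> : ((2 * n - 1) * t + k = t + 2 * (p * 2 * t + k'))%N by nia.
  rewrite -[X in _ == X %[mod _]]addn0 eqn_modDl mod0n -/(dvdn _ _).
  by rewrite -[RHS](@dvdn_pmul2l 2) // [(2 * (2 * n))%N]mulnA.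
have -> : (4 %| k)%N = ~~ odd k' by lia.
have [k'_odd|k'_even] := boolP (odd k') => /=.
  apply/eqP; rewrite cards_eq0; apply/eqP/setP => t; rewrite !inE fixE.
  apply/negP => /(dvdn_trans (dvdn_mulr n (dvdnn 2))); lia.
have rn i : (i < 4)%N -> (k' %% n + i * n < 4 * n)%N.
  by move=> i4; have := ltn_pmod k' n_gt0; nia.
(* [r] lists the four points congruent to [k'] modulo [n]. *)
pose r (i : 'I_4) : 'I_(4 * n) := Ordinal (rn i (ltn_ord i)).
have -> : [set t | (b * a ^+ k)%g t == t] = r @: setT.
  apply/setP => t; rewrite inE fixE.
  have -> : (2 * n %| p * 2 * t + k')%N = (t == k' %[mod n]).
    rewrite Gauss_dvd ?coprime2n // dvdn2 oddD -mulnA oddM oddM /= andbF /= k'_even /=.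
    have <- : (p * (2 * t) + k' + t = k' %[mod n])%N.
      have -> : (p * (2 * t) + k' + t = t * n + k')%N by nia.
      by rewrite modnMDl.
    by rewrite eq_sym -[X in _ == X %[mod _]]add0n eqn_modDr mod0n.
  apply/eqP/imsetP => [tk|[i _ ->]]; last by rewrite /= addnC modnMDl modn_mod.
  have t4 : (t %/ n < 4)%N by rewrite ltn_divLR.
  exists (Ordinal t4) => //; apply: val_inj => /=.
  by rewrite -tk addnC -divn_eq.
rewrite card_imset ?cardsT ?card_ord // => i j /(congr1 val) /= /eqP.
by rewrite eqn_add2l eqn_pmul2r // => /eqP/val_inj.
Qed.

(** For even [k] the square [a ^+ (2nk)] is trivial, so the count is half of [4n] plus the number of
    fixed points. *)
Lemma card_porbits_sd_baX k : #|porbits (b * a ^+ k)%g| =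
  (if odd k then n else if 4 %| k then 2 * n + 2 else 2 * n)%N.
Proof.
case: ifPn => [|k_even]; first exact: card_porbits_sd_baX_odd.
have inv : involutive (b * a ^+ k)%g.
  move=> t; rewrite -permM sd_baX_sqr; apply: val_inj; rewrite /= sd_aXE.
  have -> : (2 * n * k = k./2 * (4 * n))%N.
    by rewrite -{1}(even_halfK k_even) -mul2n; lia.
  by rewrite addnC modnMDl modn_small.
have := card_porbits_involutive inv; rewrite card_ord card_fix_sd_baX //.
by case: ifP => _; lia.
Qed.

End SemiDihedralElements.

(** * Sums over residues modulo [4n] and the action of multiplication by [2n - 1] *)

Section Sums.
Variables (n : nat) (n_gt0 : (0 < n)%N) (W : nmodType) (F : nat -> W).

Lemma sum_mod4 : \sum_(k < 4 * n) F (k %% 4)%N = (F 0%N + F 1%N + F 2%N + F 3%N) *+ n.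
Proof.
rewrite -(big_mkord xpredT (fun k => F (k %% 4)%N)).
elim: n => [|q IHq]; first by rewrite muln0 big_nil mulr0n.
rewrite mulnS addnC (big_cat_nat (n := (4 * q)%N)) //= ?leq_addr // IHq mulrSr.
congr (_ + _); rewrite -{1}[(4 * q)%N]add0n big_addn addKn.
rewrite !big_nat_recl // big_geq //= addr0 -!addrA.
by rewrite ![(_ + 4 * q)%N]addnC ![(4 * q)%N]mulnC !modnMDl.
Qed.

Lemma mem_overline (S : {set 'I_(4 * n)}) k : (k \in overline S) = (sd_mul k \in S).
Proof.
apply/imsetP/idP => [[l lS ->]|kS]; first by rewrite sd_mulK.
by exists (sd_mul k); rewrite ?sd_mulK.
Qed.

(** For even [k], [2nk] vanishes modulo [4n], so [sd_mul] is negation. *)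
Lemma sd_mul_even (k : 'I_(4 * n)) : ~~ odd k ->
  sd_mul k = (if k == 0 :> nat then 0 else 4 * n - k)%N :> nat.
Proof.
move=> k_even; have kN := ltn_ord k; rewrite /=.
have [q kE] : exists q, (k = q * 2 :> nat)%N by exists (k %/ 2)%N; lia.
case: eqP => [->|k0]; first by rewrite muln0 mod0n.
have -> : ((2 * n - 1) * k = (q - 1) * (4 * n) + (4 * n - k))%N.
  rewrite mulnBl mul1n mulnBl addnBA ?(ltnW kN) // mul1n subnK ?leq_pmull //; last by lia.
  by congr subn; rewrite kE; lia.
by rewrite modnMDl modn_small //; lia.
Qed.

(** For odd [k], [2nk = 2n] modulo [4n], so [sd_mul] is the reflection [k -> 2n - k]. *)
Lemma sd_mul_odd (k : 'I_(4 * n)) : odd k ->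
  sd_mul k = (if k < 2 * n then 2 * n - k else 6 * n - k)%N :> nat.
Proof.
move=> k_odd; have kN := ltn_ord k; rewrite /=.
have [q kE] : exists q, (k = q * 2 + 1 :> nat)%N by exists (k %/ 2)%N; lia.
case: ifP => k2n.
  have -> : ((2 * n - 1) * k = q * (4 * n) + (2 * n - k))%N.
    by rewrite mulnBl mul1n addnBA ?(ltnW k2n) //; congr subn; rewrite kE; lia.
  by rewrite modnMDl modn_small //; lia.
have -> : ((2 * n - 1) * k = (q - 1) * (4 * n) + (6 * n - k))%N.
  have [r qE] : exists r, (q = r + 1)%N by exists (q - 1)%N; lia.
  by rewrite mulnBl mul1n addnBA; [congr subn; rewrite kE qE addnK; lia|lia].
by rewrite modnMDl modn_small //; lia.
Qed.

Lemma gcdn_sd_mul (k : 'I_(4 * n)) : gcdn (4 * n) (sd_mul k) = gcdn (4 * n) k.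
Proof.
rewrite /= gcdn_modr Gauss_gcdr // coprimeMl.
have -> : coprime 4 (2 * n - 1) by rewrite (@coprimeXl 2 2) // coprime2n; lia.
(* Bezout coefficients: [2 n - (2n - 1) = 1]. *)
apply/coprimeP => //; exists (2, 1)%N => /=; lia.
Qed.

(** Negation fixes the even residues 0 and [2n] and sends the range from 2 to [2n - 2] onto that
    from [2n + 2] to [4n - 2]. *)
Lemma sum_even :
  \sum_(k < 4 * n | ~~ odd k) F k =
  F 0%N + F (2 * n)%N + \sum_(k in C_even n :|: overline (C_even n)) F k.
Proof.
have N0 : (0 < 4 * n)%N by lia.
have N2 : (2 * n < 4 * n)%N by lia.
rewrite (bigD1 (Ordinal N0)) //= (bigD1 (Ordinal N2)) /=; last first.
  by rewrite -val_eqE /=; lia.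
rewrite addrA; congr (_ + _); apply: eq_bigl => k; have kN := ltn_ord k.
rewrite inE mem_overline !inE -!val_eqE /=.
have [k_odd|k_even] := boolP (odd k); last first.
  by have := sd_mul_even k_even; rewrite /= => ->; case: eqP => ?; lia.
by have := sd_mul_odd k_odd; rewrite /= => ->; case: ifP => ?; lia.
Qed.

(** The reflection [k -> 2n - k] fixes the odd residues [n] and [3n]; [C_odd] contains one element
    of each remaining pair. *)
Lemma sum_odd : odd n ->
  \sum_(k < 4 * n | odd k) F k =
  F n + F (3 * n)%N + \sum_(k in C_odd n :|: overline (C_odd n)) F k.
Proof.
move=> n_odd; have N1 : (n < 4 * n)%N by lia.
have N3 : (3 * n < 4 * n)%N by lia.
rewrite (bigD1 (Ordinal N1)) //= (bigD1 (Ordinal N3)) /=; last first.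
  by rewrite -val_eqE /=; lia.
rewrite addrA; congr (_ + _); apply: eq_bigl => k; have kN := ltn_ord k.
rewrite inE mem_overline !inE -!val_eqE /=.
have [k_odd|k_even] := boolP (odd k); last first.
  by have := sd_mul_even k_even; rewrite /= => ->; case: eqP => ?; lia.
by have := sd_mul_odd k_odd; rewrite /= => ->; case: ifP => ?; lia.
Qed.

Lemma sum_C_even_overline :
  (forall k : 'I_(4 * n), k \in C_even n -> F (sd_mul k) = F k) ->
  \sum_(k in C_even n :|: overline (C_even n)) F k = (\sum_(k in C_even n) F k) *+ 2.
Proof.
move=> Fsd.
rewrite (eq_bigl [predU C_even n & overline (C_even n)]) => [|k]; last by rewrite inE.
rewrite bigU /=; last first.
  rewrite disjoint_subset; apply/subsetP => k; rewrite !inE mem_overline inE.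
  move=> /andP[k_even kC]; have := sd_mul_even k_even; rewrite /= => ->.
  by case: eqP; lia.
rewrite mulr2n big_imset /= => [|k l _ _]; last exact: (inv_inj (@sd_mulK n)).
by congr (_ + _); apply: eq_bigr => k /Fsd.
Qed.

End Sums.

(** * Evaluation of the character sums *)

Section DimensionFormulas.
Variables (R : realType) (n m : nat) (n_ge2 : (2 <= n)%N) (n_odd : odd n).
Variables (V : vectType R[i]) (dimV : \dim {:V} = m).
Variables (T : vectType R[i]) (tens : {ffun 'I_(4 * n) -> V} -> T).
Hypothesis tensP : is_tensor_power tens.
Variables (P : 'S_(4 * n) -> 'End(T)) (PP : is_permutation_operator tens P).

Local Notation dim chi := ((\dim (symmetry_class P (SD n) chi))%:R : R).
Local Notation M := (m%:R : R).
Local Notation Mgcd k := (M ^+ gcdn (4 * n) k).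
Local Notation a := (sd_a n).
Local Notation b := (sd_b n).
Local Notation Re := (@complex.Re R).

Lemma ReD (x y : R[i]) : Re (x + y) = Re x + Re y.
Proof. by case: x y => [? ?] [? ?]. Qed.

Lemma ReMr (x : R[i]) (r : R) : Re (x * r%:C) = Re x * r.
Proof. by case: x => [? ?] /=; rewrite mulr0 subr0. Qed.

Lemma real_complex_nat k : (k%:R : R[i]) = (k%:R : R)%:C.
Proof. by rewrite rmorph_nat. Qed.

(** The dimension and the powers of [m] are real, so real parts can be taken term by term in the
    trace formula. *)
Lemma dim_symmetry_class_SD (chi : 'S_(4 * n) -> R[i]) (d : nat) :
  irr_character (SD n) chi -> chi 1%g = d%:R ->
  dim chi = d%:R / (8 * n)%:R *
    (\sum_(k < 4 * n) Re (chi (a ^+ k)%g) * Mgcd k +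
     \sum_(k < 4 * n) Re (chi (b * a ^+ k)%g) *
       M ^+ (if odd k then n else if 4 %| k then 2 * n + 2 else 2 * n)%N).
Proof.
move=> irrchi chi1.
have := dim_symmetry_class tensP PP irrchi; rewrite chi1 card_SD // dimV.
rewrite [LHS]real_complex_nat => /(congr1 Re) /= ->.
rewrite (real_complex_nat d) (real_complex_nat (8 * n)) -fmorphV -rmorphM /=.
rewrite mulrC ReMr mulrC; congr (_ * _).
rewrite (big_morph Re ReD (erefl _)) sum_SD //; congr (_ + _).
  apply: eq_bigr => k _.
  by rewrite card_porbits_sd_aX // real_complex_nat ReMr natrX.
apply: eq_bigr => k _.
by rewrite card_porbits_sd_baX // real_complex_nat ReMr natrX.
Qed.

Lemma sum_sd_baX_cycles (r : nat -> R) :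
  \sum_(k < 4 * n) r (k %% 4)%N *
     M ^+ (if odd k then n else if 4 %| k then 2 * n + 2 else 2 * n)%N =
  n%:R * (r 0%N * M ^+ (2 * n + 2) + r 1%N * M ^+ n +
          r 2%N * M ^+ (2 * n) + r 3%N * M ^+ n).
Proof.
pose G k := r k * M ^+ (if odd k then n else if 4 %| k then 2 * n + 2 else 2 * n)%N.
rewrite mulr_natl -(sum_mod4 n G); apply: eq_bigr => k _; rewrite /G.
have -> : odd (k %% 4) = odd k by lia.
by have -> : (4 %| k %% 4)%N = (4 %| k)%N by lia.
Qed.

(** By multiplicativity [chi] takes the value [y x^k] at [b a^k]. The function [r] records the real
    parts of the powers of [x], which is a fourth root of unity in every use. *)
Lemma dim_linear_character (x : R[i]) (y : R) (r : nat -> R) chi :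
  sd_linear_character x y%:C chi -> (forall k, Re (x ^+ k) = r (k %% 4)%N) ->
  dim chi = 1 / (8 * n)%:R *
    (\sum_(k < 4 * n) r (k %% 4)%N * Mgcd k +
     y * n%:R * (r 0%N * M ^+ (2 * n + 2) + r 1%N * M ^+ n +
                 r 2%N * M ^+ (2 * n) + r 3%N * M ^+ n)).
Proof.
move=> [irrchi chi1 chia chib] xr.
have chiM := linear_irr_characterM irrchi chi1.
have aG : a \in SD n by rewrite mem_gen // !inE eqxx.
have bG : b \in SD n by rewrite mem_gen // !inE eqxx orbT.
have chiaX k : chi (a ^+ k)%g = x ^+ k.
  elim: k => [|k IHk]; first by rewrite expg0 chi1.
  by rewrite expgS chiM ?groupX // IHk chia exprS.
rewrite (@dim_symmetry_class_SD _ 1) //; congr (_ * (_ + _)).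
  by apply: eq_bigr => k _; rewrite chiaX xr.
rewrite -mulrA -sum_sd_baX_cycles mulr_sumr; apply: eq_bigr => k _.
by rewrite chiM ?groupX // chiaX chib [y%:C * _]mulrC ReMr xr -mulrA mulrCA.
Qed.

Lemma Mgcd_sd_mul (k : 'I_(4 * n)) : Mgcd (sd_mul k) = Mgcd k.
Proof. by rewrite gcdn_sd_mul // ltnW. Qed.

Lemma sum_parity (F : nat -> R) :
  \sum_(k < 4 * n) F k = \sum_(k < 4 * n | ~~ odd k) F k + \sum_(k < 4 * n | odd k) F k.
Proof. by rewrite (bigID (fun k : 'I_(4 * n) => odd k)) addrC. Qed.

Lemma gcd_n : gcdn (4 * n) n = n. Proof. by rewrite gcdnC gcdnMl. Qed.
Lemma gcd_2n : gcdn (4 * n) (2 * n) = (2 * n)%N.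
Proof. by rewrite -muln_gcdl. Qed.
Lemma gcd_3n : gcdn (4 * n) (3 * n) = n.
Proof. by rewrite -muln_gcdl mul1n. Qed.

Lemma dim_trivial_on_a (z : R[i]) (y : R) chi : z = y%:C ->
  sd_linear_character 1 z chi ->
  dim chi = 1 / (8 * n)%:R *
    (\sum_(k < 4 * n) Mgcd k +
     y * n%:R * (M ^+ (2 * n + 2) + M ^+ n + M ^+ (2 * n) + M ^+ n)).
Proof.
move=> -> /(@dim_linear_character _ _ (fun=> 1)) -> => [|k]; last by rewrite expr1n.
by rewrite !mul1r; congr (_ * (_ + _)); apply: eq_bigr => k _; rewrite mul1r.
Qed.

Lemma dim_sign_on_a (z : R[i]) (y : R) chi : z = y%:C ->
  sd_linear_character (-1) z chi ->
  dim chi = 1 / (8 * n)%:R *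
    (M ^+ (4 * n) + M ^+ (2 * n) - 2 * M ^+ n
     + 2 * (\sum_(k in C_even n) Mgcd k)
     - \sum_(k in C_odd n :|: overline (C_odd n)) Mgcd k
     + y * n%:R * (M ^+ (2 * n + 2) - M ^+ n + M ^+ (2 * n) - M ^+ n)).
Proof.
move=> -> /(@dim_linear_character _ _ (fun k => (-1) ^+ k)) -> => [|k]; last first.
  rewrite -[RHS]signr_odd -[in LHS]signr_odd.
  have -> : odd (k %% 4) = odd k by lia.
  by case: odd; rewrite ?expr0 ?expr1.
congr (_ * (_ + _)); last by ring.
rewrite (sum_parity (fun k => (-1) ^+ (k %% 4) * Mgcd k)).
have -> : \sum_(k < 4 * n | ~~ odd k) (-1) ^+ (k %% 4) * Mgcd k =
          \sum_(k < 4 * n | ~~ odd k) Mgcd k :> R.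
  apply: eq_bigr => k k_even; rewrite -signr_odd.
  have -> : odd (k %% 4) = false by lia.
  by rewrite mul1r.
have -> : \sum_(k < 4 * n | odd k) (-1) ^+ (k %% 4) * Mgcd k =
          - \sum_(k < 4 * n | odd k) Mgcd k :> R.
  rewrite -sumrN; apply: eq_bigr => k k_odd; rewrite -signr_odd.
  have -> : odd (k %% 4) = true by lia.
  by rewrite mulN1r.
(* The residues 0 and [2n] give [m^(4n) + m^(2n)]; [n] and [3n], both of gcd [n] with [4n], give
   [- 2 m^n]. *)
rewrite (sum_even (ltnW n_ge2) (fun k => Mgcd k)).
rewrite (sum_odd (ltnW n_ge2) (fun k => Mgcd k)) //.
rewrite (sum_C_even_overline (ltnW n_ge2) (F := fun k => Mgcd k)) => [|k _];
  last exact: Mgcd_sd_mul.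
by rewrite gcdn0 gcd_n gcd_2n gcd_3n; ring.
Qed.

(** Only [x ^+ 2 = -1] matters: odd powers of [x] are imaginary and even ones are signs. Hence [i]
    and [-i] give the same dimension. *)
Lemma dim_i_on_a (x z : R[i]) (y : R) chi : x = 'i%C \/ x = - 'i%C -> z = y%:C ->
  sd_linear_character x z chi ->
  dim chi = 1 / (8 * n)%:R *
    (M ^+ (4 * n) - M ^+ (2 * n)
     + \sum_(k in C_even n :|: overline (C_even n)) (-1) ^+ (k %/ 2) * Mgcd k
     + y * n%:R * (M ^+ (2 * n + 2) - M ^+ (2 * n))).
Proof.
move=> xi -> chiP.
pose r k : R := if odd k then 0 else (-1) ^+ (k %/ 2).
have i2 : x ^+ 2 = -1 by case: xi => ->; rewrite ?sqrrN sqr_i.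
have rE k : Re (x ^+ k) = r k.
  rewrite /r {1}(divn_eq k 2) exprD mulnC exprM i2 modn2.
  have -> : (-1) ^+ (k %/ 2) = ((-1) ^+ (k %/ 2) : R)%:C.
    by rewrite -signr_odd -[in RHS]signr_odd; case: odd; rewrite ?expr1 //= raddfN.
  rewrite mulrC ReMr; case: odd; last by rewrite expr0 mul1r.
  by case: xi => ->; rewrite /= ?oppr0 mul0r.
have r4 k : r (k %% 4)%N = r k.
  rewrite /r; have -> : odd (k %% 4) = odd k by lia.
  case: ifP => // k_even; rewrite -signr_odd -[RHS]signr_odd.
  by congr ((-1) ^+ (nat_of_bool _)); lia.
rewrite (dim_linear_character (r := r) chiP) => [|k]; last by rewrite r4.
congr (_ * (_ + _)); last by rewrite /r /=; ring.
under eq_bigr do rewrite r4.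
rewrite (sum_parity (fun k => r k * Mgcd k)).
rewrite [X in _ + X]big1 => [|k]; last by rewrite /r => ->; rewrite mul0r.
rewrite (sum_even (ltnW n_ge2) (fun k => r k * Mgcd k)) addr0.
have -> : r 0%N = 1 by [].
(* The sign is [(-1)^n], with [n] odd. *)
have -> : r (2 * n)%N = -1 by rewrite /r oddM mulKn // -signr_odd n_odd.
rewrite gcdn0 gcd_2n mul1r mulN1r; congr (_ + _); apply: eq_bigr => k.
rewrite inE mem_overline !inE /r; case: ifP => // k_odd.
by rewrite (sd_mul_odd (ltnW n_ge2) k_odd); case: ifP; lia.
Qed.

Local Notation angle h k := ((h * k)%:R * pi / (2 * n)%:R : R).

(** The two angles add up to [h] full turns. *)
Lemma cos_angle_reflect h k : (k <= 4 * n)%N ->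
  cos (angle h (4 * n - k)) = cos (angle h k).
Proof.
move=> kN; rewrite -[RHS]cosN -(periodicn (@cosD2pi R) h (- _)); congr cos.
have n_neq0 : n%:R != 0 :> R by rewrite pnatr_eq0; lia.
by rewrite -mulrnA -[in RHS]mulr_natl !natrM natrB // natrM; field.
Qed.

Lemma dim_varsigma h chi : sd_varsigma h chi ->
  dim chi = 1 / (2 * n)%:R * \sum_(k < 4 * n) Mgcd k * cos (angle h k).
Proof.
move=> [irrchi chiE].
have chi1 : chi 1%g = 2%:R.
  have [+ _] := chiE 0%N; rewrite expg0 => ->.
  by rewrite muln0 !mul0r cos0 mulr1 rmorph_nat.
rewrite (dim_symmetry_class_SD irrchi chi1).
rewrite [X in _ + X]big1 ?addr0 => [|k _]; last by have [_ ->] := chiE k; rewrite mul0r.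
rewrite (_ : 1 / (2 * n)%:R = 2 / (8 * n)%:R * 2 :> R); last first.
  by field; rewrite ?pnatr_eq0; lia.
rewrite -[RHS]mulrA [2 * \sum_(_ < _) _]mulr_sumr; congr (_ * _); apply: eq_bigr => k _.
by have [-> _] := chiE k; rewrite /= -mulrA [cos _ * _]mulrC.
Qed.

(** The values at odd powers of [a] are imaginary and drop out; at even powers the cosine is
    invariant under negating [k], which doubles the sum over [C_even]. *)
Lemma dim_psi h chi : odd h -> sd_psi h chi ->
  dim chi = 1 / (4 * n)%:R *
    (2 * M ^+ (4 * n) - 2 * M ^+ (2 * n)
     + 4 * (\sum_(k in C_even n) Mgcd k * cos (angle h k))).
Proof.
move=> h_odd [irrchi chiE].
have chi1 : chi 1%g = 2%:R.
  have [+ _] := chiE 0%N; rewrite expg0 => ->.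
  by rewrite muln0 !mul0r cos0 mulr1 rmorph_nat.
rewrite (dim_symmetry_class_SD irrchi chi1).
rewrite [X in _ + X]big1 ?addr0 => [|k _]; last by have [_ ->] := chiE k; rewrite mul0r.
pose F k := Mgcd k * cos (angle h k).
rewrite (sum_parity (fun k => Re (chi (a ^+ k)%g) * Mgcd k)).
rewrite [X in _ + X]big1 ?addr0 => [|k k_odd]; last first.
  by have [-> _] := chiE k; rewrite k_odd mul0r.
have -> : \sum_(k < 4 * n | ~~ odd k) Re (chi (a ^+ k)%g) * Mgcd k =
          2 * \sum_(k < 4 * n | ~~ odd k) F k.
  rewrite mulr_sumr; apply: eq_bigr => k /negPf k_even.
  by have [-> _] := chiE k; rewrite k_even /= -mulrA [cos _ * _]mulrC.
rewrite (sum_even (ltnW n_ge2) F) (sum_C_even_overline (ltnW n_ge2) (F := F)); last first.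
  move=> k; rewrite inE => /andP[k_even kC].
  rewrite /F Mgcd_sd_mul; congr (_ * _).
  rewrite (sd_mul_even (ltnW n_ge2) k_even); case: eqP => [->//|_].
  by rewrite cos_angle_reflect // ltnW.
have n_neq0 : n%:R != 0 :> R by rewrite pnatr_eq0; lia.
have -> : F 0%N = M ^+ (4 * n) by rewrite /F gcdn0 muln0 !mul0r cos0 mulr1.
have -> : F (2 * n)%N = - M ^+ (2 * n).
  (* The angle is [h pi] with [h] odd, so its cosine is -1. *)
  rewrite /F gcd_2n (_ : angle h (2 * n) = pi + (pi *+ 2) *+ h./2); last first.
    rewrite -{1}(odd_double_half h) h_odd -[nat_of_bool true]/1%N -mul2n.
    rewrite -mulrnA -[in RHS]mulr_natl.
    by rewrite !natrM natrD natrM; field.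
  by rewrite (periodicn (@cosD2pi R)) cospi mulrN1.
by rewrite /F !natrM; field.
Qed.

End DimensionFormulas.

(* The last formula corrects the printed one, which has
   m^(4n) - m^(2n) in place of 2 m^(4n) - 2 m^(2n): the term of the identity
   in the trace of T(G, psi) is psi(1) m^(4n) = 2 m^(4n), and that of a^(2n) is
   psi(a^(2n)) m^(2n) = - 2 m^(2n). For n = 3, m = 2, h' = 1 the dimension
   is 670; the printed formula gives 334. *)
Theorem theorem2p9 (R : realType) (n m : nat) (n_ge2 : (2 <= n)%N)
    (n_odd : odd n)
    (V : vectType R[i]) (dotV : {dot V for Num.conj}) (dimV : \dim {:V} = m)
    (T : vectType R[i]) (tens : {ffun 'I_(4 * n) -> V} -> T)
    (tensP : is_tensor_power tens)
    (P : 'S_(4 * n) -> 'End(T)) (PP : is_permutation_operator tens P)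
    (h h' : 'I_(4 * n)) (h_even : h \in C_even n) (h'_odd : h' \in C_odd23 n)
    (h'_neqn : h' != n :> nat) (h'_neq3n : h' != (3 * n)%N :> nat) :
  let dim (chi : 'S_(4 * n) -> R[i]) : R :=
    (\dim (symmetry_class P (SD n) chi))%:R in
  let M : R := m%:R in
  let Mgcd (k : nat) : R := M ^+ gcdn (4 * n) k in
  (forall chi0, sd_linear_character 1 1 chi0 ->
     dim chi0 = 1 / (8 * n)%:R *
       ((2 * n)%:R * M ^+ n + n%:R * M ^+ (2 * n) + n%:R * M ^+ (2 * n + 2)
        + \sum_(0 <= k < 4 * n) Mgcd k)) /\
  (forall chi1, sd_linear_character 1 (-1) chi1 ->
     dim chi1 = 1 / (8 * n)%:R *
       (- (2 * n)%:R * M ^+ n - n%:R * M ^+ (2 * n) - n%:R * M ^+ (2 * n + 2)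
        + \sum_(0 <= k < 4 * n) Mgcd k)) /\
  (forall chi2, sd_linear_character (-1) 1 chi2 ->
     dim chi2 = 1 / (8 * n)%:R *
       (M ^+ (4 * n) + M ^+ (2 * n) - 2 * M ^+ n
        + 2 * (\sum_(k in C_even n) Mgcd k)
        - \sum_(k in C_odd n :|: overline (C_odd n)) Mgcd k
        - (2 * n)%:R * M ^+ n + n%:R * M ^+ (2 * n)
        + n%:R * M ^+ (2 * n + 2))) /\
  (forall chi3, sd_linear_character (-1) (-1) chi3 ->
     dim chi3 = 1 / (8 * n)%:R *
       (M ^+ (4 * n) + M ^+ (2 * n) - 2 * M ^+ n
        + 2 * (\sum_(k in C_even n) Mgcd k)
        - \sum_(k in C_odd n :|: overline (C_odd n)) Mgcd k
        + (2 * n)%:R * M ^+ n - n%:R * M ^+ (2 * n)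
        - n%:R * M ^+ (2 * n + 2))) /\
  (forall chi4, sd_linear_character 'i%C 1 chi4 ->
     dim chi4 = 1 / (8 * n)%:R *
       (M ^+ (4 * n) - M ^+ (2 * n)
        + \sum_(k in C_even n :|: overline (C_even n)) (-1) ^+ (k %/ 2) * Mgcd k
        + n%:R * M ^+ (2 * n + 2) - n%:R * M ^+ (2 * n))) /\
  (forall chi5, sd_linear_character 'i%C (-1) chi5 ->
     dim chi5 = 1 / (8 * n)%:R *
       (M ^+ (4 * n) - M ^+ (2 * n)
        + \sum_(k in C_even n :|: overline (C_even n)) (-1) ^+ (k %/ 2) * Mgcd k
        - n%:R * M ^+ (2 * n + 2) + n%:R * M ^+ (2 * n))) /\
  (forall chi6, sd_linear_character (- 'i%C) 1 chi6 ->
     dim chi6 = 1 / (8 * n)%:R *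
       (M ^+ (4 * n) - M ^+ (2 * n)
        + \sum_(k in C_even n :|: overline (C_even n)) (-1) ^+ (k %/ 2) * Mgcd k
        + n%:R * M ^+ (2 * n + 2) - n%:R * M ^+ (2 * n))) /\
  (forall chi7, sd_linear_character (- 'i%C) (-1) chi7 ->
     dim chi7 = 1 / (8 * n)%:R *
       (M ^+ (4 * n) - M ^+ (2 * n)
        + \sum_(k in C_even n :|: overline (C_even n)) (-1) ^+ (k %/ 2) * Mgcd k
        - n%:R * M ^+ (2 * n + 2) + n%:R * M ^+ (2 * n))) /\
  (forall varsigma, sd_varsigma h varsigma ->
     dim varsigma = 1 / (2 * n)%:R *
       (\sum_(0 <= k < 4 * n)
           Mgcd k * cos ((h * k)%:R * pi / (2 * n)%:R))) /\
  (forall psi, sd_psi h' psi ->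
     dim psi = 1 / (4 * n)%:R *
       (2 * M ^+ (4 * n) - 2 * M ^+ (2 * n)
        + 4 * (\sum_(k in C_even n)
                  Mgcd k * cos ((h' * k)%:R * pi / (2 * n)%:R)))).
Proof.
move=> dim M Mgcd.
have sumE (F : nat -> R) : \sum_(0 <= k < 4 * n) F k = \sum_(k < 4 * n) F k.
  by rewrite big_mkord.
have h'_isodd : odd h' by move: h'_odd; rewrite inE => /andP[].
have C1 : (1 : R[i]) = (1 : R)%:C by [].
have CN1 : (-1 : R[i]) = (-1 : R)%:C by rewrite rmorphN1.
(* The linear characters are treated according to their value at [a]; [C1] and [CN1] set the value
   [y] at [b] to 1 or -1. *)
rewrite !sumE; do !apply: conj => [chi|].
- move=> /(dim_trivial_on_a n_ge2 n_odd dimV tensP PP C1) dimE.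
  by rewrite /dim dimE; congr (_ * _); rewrite -/M ?natrM; ring.
- move=> /(dim_trivial_on_a n_ge2 n_odd dimV tensP PP CN1) dimE.
  by rewrite /dim dimE; congr (_ * _); rewrite -/M ?natrM; ring.
- move=> /(dim_sign_on_a n_ge2 n_odd dimV tensP PP C1) dimE.
  by rewrite /dim dimE; congr (_ * _); rewrite -/M ?natrM; ring.
- move=> /(dim_sign_on_a n_ge2 n_odd dimV tensP PP CN1) dimE.
  by rewrite /dim dimE; congr (_ * _); rewrite -/M ?natrM; ring.
- move=> /(dim_i_on_a n_ge2 n_odd dimV tensP PP (or_introl erefl) C1) dimE.
  by rewrite /dim dimE; congr (_ * _); rewrite -/M ?natrM; ring.
- move=> /(dim_i_on_a n_ge2 n_odd dimV tensP PP (or_introl erefl) CN1) dimE.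
  by rewrite /dim dimE; congr (_ * _); rewrite -/M ?natrM; ring.
- move=> /(dim_i_on_a n_ge2 n_odd dimV tensP PP (or_intror erefl) C1) dimE.
  by rewrite /dim dimE; congr (_ * _); rewrite -/M ?natrM; ring.
- move=> /(dim_i_on_a n_ge2 n_odd dimV tensP PP (or_intror erefl) CN1) dimE.
  by rewrite /dim dimE; congr (_ * _); rewrite -/M ?natrM; ring.
- exact: (dim_varsigma n_ge2 n_odd dimV tensP PP).
- move=> chi; exact: (dim_psi n_ge2 n_odd dimV tensP PP h'_isodd).
Qed.
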